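(* Let $(R,\mathfrak{m})$ be a one-dimensional Cohen–Macaulay local ring and let $I,J$ be regular stable trace ideals of $R$. Then $$\operatorname{Hom}_R(I,J)\cong\operatorname{Hom}_R(J,I)\cong\operatorname{tr}(IJ).$$ If moreover $I\cap J$ is also a stable trace ideal, then $\operatorname{tr}(IJ)\cong I\cap J$.
   Context: An ideal is regular if it contains a nonzerodivisor. For an $R$-module $N$, $N^*=\operatorname{Hom}_R(N,R)$ and $\operatorname{tr}(N)$ is the image of $N\otimes_R N^*\to R$, $n\otimes\alpha\mapsto\alpha(n)$; an ideal $I$ is a trace ideal if $I=\operatorname{tr}(N)$ for some $R$-module $N$ (equivalently $\operatorname{tr}(I)=I$). $Q(R)$ is the total quotient ring. For a regular ideal $I$, $B_R(I)=\bigcup_{n>0}(I^n:_{Q(R)}I^n)$, and $I$ is stable if $B_R(I)=I:_{Q(R)}I$. *)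

(* Defs.v *)
From mathcomp Require Import all_boot all_algebra.
Set Implicit Arguments. Unset Strict Implicit. Unset Printing Implicit Defensive.
Import GRing.Theory.
Local Open Scope ring_scope.

Section CommAlg.
Variable R : comNzRingType.

Definition subset (A B : R -> Prop) := forall x, A x -> B x.
Definition same (A B : R -> Prop) := forall x, A x <-> B x.

Definition is_ideal (I : R -> Prop) : Prop :=
  I 0 /\ (forall x y, I x -> I y -> I (x + y)) /\ (forall r x, I x -> I (r * x)).

Definition is_prime (P : R -> Prop) : Prop :=
  is_ideal P /\ ~ P 1 /\ (forall a b, P (a * b) -> P a \/ P b).

Definition is_maximal (M : R -> Prop) : Prop :=
  is_ideal M /\ ~ M 1 /\
  (forall J, is_ideal J -> subset M J -> same J M \/ J 1).

Definition strict_sub (A B : R -> Prop) := subset A B /\ exists x, B x /\ ~ A x.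

Definition gen_by (s : seq R) (x : R) : Prop :=
  exists c : seq R, size c = size s /\ x = \sum_(i < size s) c`_i * s`_i.

Definition noetherian : Prop :=
  forall I, is_ideal I -> exists s : seq R, same I (gen_by s).

Definition local_with (m : R -> Prop) : Prop :=
  is_maximal m /\ forall M, is_maximal M -> same M m.

Definition krull_dim_one : Prop :=
  (exists P Q, is_prime P /\ is_prime Q /\ strict_sub P Q) /\
  ~ (exists P Q S, is_prime P /\ is_prime Q /\ is_prime S /\
       strict_sub P Q /\ strict_sub Q S).

Definition nzd (x : R) : Prop := forall y, x * y = 0 -> y = 0.

(* one-dimensional Cohen-Macaulay local ring: depth m >= 1 = dim R,
   i.e. m contains an R-regular element *)
Definition CM1_local (m : R -> Prop) : Prop :=
  noetherian /\ local_with m /\ krull_dim_one /\ exists x, m x /\ nzd x.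

Definition regular (I : R -> Prop) : Prop := exists x, I x /\ nzd x.

Definition iprod (I J : R -> Prop) (x : R) : Prop :=
  exists s : seq (R * R), (forall p, p \in s -> I p.1 /\ J p.2) /\
    x = \sum_(p <- s) p.1 * p.2.

Fixpoint ipow (I : R -> Prop) (n : nat) : R -> Prop :=
  match n with 0 => (fun _ => True) | n'.+1 => iprod (ipow I n') I end.

Definition icap (I J : R -> Prop) (x : R) : Prop := I x /\ J x.

(* Hom_R(I, J), elements represented as functions R -> R which vanish
   off I (so that each homomorphism I -> J has a unique representative). *)
Definition Hom (I J : R -> Prop) (f : R -> R) : Prop :=
  (forall x, I x -> J (f x)) /\
  (forall x y, I x -> I y -> f (x + y) = f x + f y) /\
  (forall r x, I x -> f (r * x) = r * f x) /\
  (forall x, ~ I x -> f x = 0).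

Definition tr (K : R -> Prop) (x : R) : Prop :=
  exists s : seq ((R -> R) * R),
    (forall i, (i < size s)%N -> Hom K (fun _ => True) (nth (fun _ => 0, 0) s i).1
                                /\ K (nth (fun _ => 0, 0) s i).2) /\
    x = \sum_(i < size s) (nth (fun _ => 0, 0) s i).1 (nth (fun _ => 0, 0) s i).2.

Definition trace_ideal (I : R -> Prop) : Prop := is_ideal I /\ same (tr I) I.

(* Membership of the fraction a/s (s a nonzerodivisor) in (K :_{Q(R)} L):
   (a/s) L subset K in Q(R), i.e. for each x in L, a x = s y for some y in K. *)
Definition frac_colon (K L : R -> Prop) (a s : R) : Prop :=
  forall x, L x -> exists y, K y /\ a * x = s * y.

(* regular ideal I is stable: B_R(I) = (I :_Q I), where
   B_R(I) = union_{n>0} (I^n :_Q I^n)  (the inclusion (I:I) in B_R(I) is trivial) *)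
Definition stable (I : R -> Prop) : Prop :=
  is_ideal I /\ regular I /\
  forall a s, nzd s ->
    (exists n, (0 < n)%N /\ frac_colon (ipow I n) (ipow I n) a s) ->
    frac_colon I I a s.

Definition mod_iso (T1 T2 : Type)
  (add1 : T1 -> T1 -> T1) (sc1 : R -> T1 -> T1) (P1 : T1 -> Prop)
  (add2 : T2 -> T2 -> T2) (sc2 : R -> T2 -> T2) (P2 : T2 -> Prop) : Prop :=
  exists phi : T1 -> T2,
    (forall u, P1 u -> P2 (phi u)) /\
    (forall u v, P1 u -> P1 v -> phi u = phi v -> u = v) /\
    (forall w, P2 w -> exists u, P1 u /\ phi u = w) /\
    (forall u v, P1 u -> P1 v -> phi (add1 u v) = add2 (phi u) (phi v)) /\
    (forall r u, P1 u -> phi (sc1 r u) = sc2 r (phi u)).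

Definition fadd (f g : R -> R) : R -> R := fun x => f x + g x.
Definition fscale (r : R) (f : R -> R) : R -> R := fun x => r * f x.
Definition radd (x y : R) : R := x + y.
Definition rscale (r x : R) : R := r * x.

Definition iso_HH (I J K L : R -> Prop) : Prop :=
  mod_iso fadd fscale (Hom I J) fadd fscale (Hom K L).
Definition iso_HI (I J K : R -> Prop) : Prop :=
  mod_iso fadd fscale (Hom I J) radd rscale K.
Definition iso_II (I J : R -> Prop) : Prop :=
  mod_iso radd rscale I radd rscale J.

End CommAlg.

(* Main.v *)
(* Write Q for the total quotient ring of R. If I is a trace ideal then
   (I : I) = (R : I) =: A, and if I is moreover stable then I = xA for some x in I.
   With J = yB in the same way, (J : I) = (R : IB) = (A : B) and (I : J) = (B : A)
   differ by the factor y/x, and tr(IJ) = xyAB(R : IJ) = x(A : B).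
   If K, the intersection of I and J, is also a trace ideal, then (R : K) = (K : K) is
   a ring containing A and B, hence AB, so K is contained in (R : AB) = tr(IJ).
   That a stable ideal is of the form xA follows from the existence of reductions of I
   in two consecutive degrees; an arbitrary residue field is handled by allowing all
   large degrees. Elements of Q are represented by their numerators over a power of a
   suitable nonzerodivisor. *)
Require Import Defs.
From mathcomp Require Import all_boot all_algebra.
From mathcomp Require Import ring zify.
From Stdlib Require Import Classical ClassicalEpsilon.
From Stdlib Require Import FunctionalExtensionality PropExtensionality.
Set Implicit Arguments. Unset Strict Implicit. Unset Printing Implicit Defensive.
Import GRing.Theory.
Local Open Scope ring_scope.

(** * Ideals, maximal elements and primes *)

Section Ideals.
Variable R : comNzRingType.
Implicit Types (I J K L X P : R -> Prop) (a b r t u v w x y z : R).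

Lemma same_eq I J : same I J -> I = J.
Proof.
by move=> e; apply: functional_extensionality => t; apply: propositional_extensionality.
Qed.

Lemma ideal0 I : is_ideal I -> I 0.
Proof. by case. Qed.

Lemma idealD I x y : is_ideal I -> I x -> I y -> I (x + y).
Proof. by case=> _ [+ _]; apply. Qed.

Lemma idealM I r x : is_ideal I -> I x -> I (r * x).
Proof. by case=> _ [_]; apply. Qed.

Lemma ideal_mulr I r x : is_ideal I -> I x -> I (x * r).
Proof. by rewrite mulrC; apply: idealM. Qed.

Lemma idealN I x : is_ideal I -> I x -> I (- x).
Proof. by move=> hI hx; rewrite -mulN1r; apply: idealM. Qed.

Lemma idealB I x y : is_ideal I -> I x -> I y -> I (x - y).
Proof. by move=> hI hx hy; apply: idealD => //; apply: idealN. Qed.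

Lemma ideal_sum I (T : eqType) (s : seq T) (F : T -> R) :
  is_ideal I -> (forall i, i \in s -> I (F i)) -> I (\sum_(i <- s) F i).
Proof.
move=> hI hF; rewrite big_seq; apply: (big_ind I) => //; first exact: ideal0.
by move=> ? ?; apply: idealD.
Qed.

Lemma ideal_sum_ord I n (F : 'I_n -> R) :
  is_ideal I -> (forall i, I (F i)) -> I (\sum_i F i).
Proof. by move=> hI hF; apply: ideal_sum. Qed.

Definition adj I x : R -> Prop := fun t => exists u c, I u /\ t = u + c * x.

Lemma adj_ideal I x : is_ideal I -> is_ideal (adj I x).
Proof.
move=> hI; split; first by exists 0, 0; rewrite mul0r addr0; split=> //; apply: ideal0.
split=> [_ _ [u [c [hu ->]]] [v [d [hv ->]]]|r _ [u [c [hu ->]]]].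
  by exists (u + v), (c + d); split; [apply: idealD | ring].
by exists (r * u), (r * c); split; [apply: idealM | ring].
Qed.

Lemma adj_sub I x u : I u -> adj I x u.
Proof. by move=> hu; exists u, 0; rewrite mul0r addr0. Qed.

Lemma adj_mem I x : is_ideal I -> adj I x x.
Proof. by move=> hI; exists 0, 1; rewrite mul1r add0r; split=> //; apply: ideal0. Qed.

Definition princ x : R -> Prop := fun t => exists r, t = r * x.

Lemma princ_ideal x : is_ideal (princ x).
Proof.
split; first by exists 0; rewrite mul0r.
split=> [_ _ [r ->] [s ->]|r _ [s ->]].
  by exists (r + s); rewrite mulrDl.
by exists (r * s); rewrite mulrA.
Qed.

Lemma princ_mem x : princ x x.
Proof. by exists 1; rewrite mul1r. Qed.

Lemma gen_by_mem (s : seq R) i : (i < size s)%N -> gen_by s s`_i.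
Proof.
move=> hi; exists (mkseq (fun j => (j == i)%:R) (size s)).
split; first by rewrite size_mkseq.
rewrite (bigD1 (Ordinal hi)) //= nth_mkseq // eqxx mul1r big1 ?addr0 //.
move=> j; rewrite -val_eqE /= => /negPf ji.
by rewrite nth_mkseq ?ltn_ord // ji mul0r.
Qed.

Lemma gen_by_sub K (s : seq R) :
  is_ideal K -> (forall i, (i < size s)%N -> K s`_i) -> Defs.subset (gen_by s) K.
Proof.
move=> hK hs _ [c [_ ->]]; apply: ideal_sum_ord => // i.
by apply: idealM => //; apply: hs.
Qed.

(** Without a maximal member, choice gives a strictly increasing chain in [F]; finitely many
    generators of its union already lie in one term. *)
Lemma noetherian_max (F : (R -> Prop) -> Prop) (I0 : R -> Prop) :
  noetherian R -> (forall I, F I -> is_ideal I) -> F I0 ->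
  exists M, F M /\ forall J, F J -> Defs.subset M J -> Defs.subset J M.
Proof.
move=> noeth Fid F0; apply: NNPP => nomax.
have step (M : {M | F M}) :
    {J : {J | F J} | Defs.subset (sval M) (sval J) /\ ~ Defs.subset (sval J) (sval M)}.
  apply: constructive_indefinite_description; apply: NNPP => no; apply: nomax.
  exists (sval M); split; first exact: svalP.
  move=> J FJ sMJ; apply: NNPP => nJM; apply: no.
  by exists (exist _ J FJ).
pose S n := sval (iter n (fun M => sval (step M)) (exist _ I0 F0)).
have SF n : F (S n) by apply: svalP.
have SS n : Defs.subset (S n) (S n.+1) /\ ~ Defs.subset (S n.+1) (S n).
  exact: (svalP (step _)).
have Smon n k x : S n x -> S (n + k)%N x.
  by move=> hx; elim: k => [|k IH]; rewrite ?addn0 // addnS; apply: (SS _).1.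
have Uid : is_ideal (fun x => exists n, S n x).
  split; first by exists 0; apply: ideal0; apply: Fid.
  split=> [x y [n hx] [k hy]|r x [n hx]].
    exists (n + k)%N; apply: idealD; [exact: Fid|exact: Smon|].
    by rewrite addnC; apply: Smon.
  by exists n; apply: idealM => //; apply: Fid.
have [s es] := noeth _ Uid.
have [n hn] : exists n, forall i, (i < size s)%N -> S n s`_i.
  suff H k : (k <= size s)%N -> exists n, forall i, (i < k)%N -> S n s`_i by apply: H.
  elim: k => [_|k IH hk]; first by exists 0.
  have [n hn] := IH (ltnW hk).
  have [p hp] := (es s`_k).2 (gen_by_mem hk).
  exists (n + p)%N => i; rewrite ltnS leq_eqVlt => /orP[/eqP ->|/hn].
    by rewrite addnC; apply: Smon.
  exact: Smon.
apply: (SS n).2 => x hx; apply: (gen_by_sub (Fid _ (SF n)) hn).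
by apply: (es x).1; exists n.+1.
Qed.

(** If a and b lie outside [P], then P + aR and P + bR both meet [S]; the product of the two
    elements found there lies in [P] once ab does. *)
Lemma maximal_disjoint_prime (S P : R -> Prop) :
  S 1 -> (forall a b, S a -> S b -> S (a * b)) ->
  is_ideal P -> (forall x, P x -> ~ S x) ->
  (forall J, is_ideal J -> (forall x, J x -> ~ S x) ->
     Defs.subset P J -> Defs.subset J P) ->
  is_prime P.
Proof.
move=> S1 SM hP dP maxP; split=> //; split; first by move=> /dP.
have meets a : ~ P a -> exists r p, P p /\ S (p + r * a).
  move=> nPa; apply: NNPP => no; apply: nPa.
  apply: (maxP (adj P a)); [exact: adj_ideal| |exact: adj_sub|exact: adj_mem].
  by move=> _ [u [c [hu ->]]] hS; apply: no; exists c, u.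
move=> a b Pab; apply: NNPP => /not_or_and[/meets[r [p [Pp Sp]]] /meets[s [q [Pq Sq]]]].
apply: dP (SM _ _ Sp Sq).
have -> : (p + r * a) * (q + s * b) = (q + s * b) * p + (r * a) * q + (r * s) * (a * b).
  by ring.
by apply: idealD => //; [apply: idealD => //|]; apply: idealM.
Qed.

(** * Nonzerodivisors, colons, products and powers of ideals *)

Lemma nzdM x y : nzd x -> nzd y -> nzd (x * y).
Proof. by move=> hx hy t; rewrite -mulrA => /hx /hy. Qed.

Lemma nzd1 : nzd (1 : R).
Proof. by move=> t; rewrite mul1r. Qed.

Lemma nzdX x n : nzd x -> nzd (x ^+ n).
Proof.
move=> hx; elim: n => [|n IH]; first by rewrite expr0; apply: nzd1.
by rewrite exprS; apply: nzdM.
Qed.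

Lemma nzd_cancel x y z : nzd x -> x * y = x * z -> y = z.
Proof.
by move=> hx e; apply/eqP; rewrite -subr_eq0; apply/eqP/hx; rewrite mulrBr e subrr.
Qed.

Lemma nzd_divl x y : nzd (x * y) -> nzd x.
Proof. by move=> h t e; apply: h; rewrite mulrAC e mul0r. Qed.

Definition colon K u : R -> Prop := fun t => K (t * u).

Lemma colon_ideal K u : is_ideal K -> is_ideal (colon K u).
Proof.
move=> hK; split; first by rewrite /colon mul0r; apply: ideal0.
split=> [s t|r s]; rewrite /colon; first by rewrite mulrDl; apply: idealD.
by rewrite -mulrA; apply: idealM.
Qed.

Definition mulset w L : R -> Prop := fun t => exists2 s, L s & t = w * s.

Lemma mulset_ideal w L : is_ideal L -> is_ideal (mulset w L).
Proof.
move=> hL; split; first by exists 0; rewrite ?mulr0 //; apply: ideal0.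
split=> [_ _ [s Ls ->] [t Lt ->]|r _ [s Ls ->]].
  by exists (s + t); rewrite ?mulrDr //; apply: idealD.
by exists (r * s); [apply: idealM | ring].
Qed.

Lemma iprod_ideal I J : is_ideal I -> is_ideal (iprod I J).
Proof.
move=> hI; split; first by exists [::]; rewrite big_nil.
split=> [_ _ [s [hs ->]] [t [ht ->]]|r _ [s [hs ->]]].
  exists (s ++ t); rewrite big_cat; split=> // p.
  by rewrite mem_cat => /orP[/hs|/ht].
exists [seq (r * p.1, p.2) | p <- s]; split.
  by move=> _ /mapP[p /hs[hp1 hp2] ->]; split=> //=; apply: idealM.
by rewrite big_map mulr_sumr; apply: eq_bigr => p _; rewrite mulrA.
Qed.

Lemma iprod_mem I J u v : I u -> J v -> iprod I J (u * v).
Proof.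
move=> hu hv; exists [:: (u, v)]; rewrite big_seq1; split=> // p.
by rewrite inE => /eqP ->.
Qed.

Lemma iprod_sub I J K : is_ideal K ->
  (forall u v, I u -> J v -> K (u * v)) -> Defs.subset (iprod I J) K.
Proof.
move=> hK h _ [s [hs ->]]; apply: ideal_sum => // p /hs[? ?].
exact: h.
Qed.

Lemma ipow_ideal I n : is_ideal I -> is_ideal (ipow I n).
Proof. by move=> hI; elim: n => [//|n IH]; apply: iprod_ideal. Qed.

Lemma ipowD_mem I p q u v : is_ideal I ->
  ipow I p u -> ipow I q v -> ipow I (p + q) (u * v).
Proof.
move=> hI hu; elim: q v => [|q IH] v.
  by rewrite addn0 => _; apply: ideal_mulr => //; apply: ipow_ideal.
rewrite mulrC addnS.
apply: (@iprod_sub _ _ (colon (ipow I (p + q).+1) u)).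
  by apply: colon_ideal; apply: (ipow_ideal (p + q).+1).
move=> s t hs ht; rewrite /colon mulrC mulrA.
by apply: iprod_mem => //; apply: IH.
Qed.

Lemma ipowD_sub I K p q : is_ideal K ->
  (forall u v, ipow I p u -> ipow I q v -> K (u * v)) ->
  Defs.subset (ipow I (p + q)) K.
Proof.
elim: q K => [|q IH] K hK h.
  by rewrite addn0 => t ht; rewrite -[t]mulr1; apply: h.
rewrite addnS; apply: iprod_sub => // t b ht hb.
apply: (IH (colon K b)) => //; first exact: colon_ideal.
move=> u v hu hv; rewrite /colon -mulrA; apply: h => //.
exact: iprod_mem.
Qed.

Lemma ipowX I p u n : is_ideal I -> ipow I p u -> ipow I (p * n) (u ^+ n).
Proof.
move=> hI hu; elim: n => [|n IH]; first by rewrite muln0.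
by rewrite mulnS exprS; apply: ipowD_mem.
Qed.

Lemma ipow1_mem I u : I u -> ipow I 1 u.
Proof. by move=> hu; rewrite -[u]mul1r; apply: iprod_mem. Qed.

Lemma ipowS_sub I n : is_ideal I -> Defs.subset (ipow I n.+1) I.
Proof. by move=> hI; apply: iprod_sub => // u v _; apply: idealM. Qed.

Lemma ipow_mono I J n : is_ideal J -> Defs.subset I J ->
  Defs.subset (ipow I n) (ipow J n).
Proof.
move=> hJ sIJ; elim: n => [//|n IH]; apply: iprod_sub.
  exact: (ipow_ideal n.+1).
by move=> u v hu hv; apply: iprod_mem; [apply: IH|apply: sIJ].
Qed.

(** In a product of n + 1 factors from I + xR, every term but the multiple of x^(n+1) has a factor
    in [I]. *)
Lemma ipow_adj_sub I K x n : is_ideal I -> is_ideal K ->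
  K (x ^+ n.+1) -> (forall u v, I u -> ipow (adj I x) n v -> K (u * v)) ->
  Defs.subset (ipow (adj I x) n.+1) K.
Proof.
move=> hI; elim: n K => [|n IH] K hK Kx KI;
  apply: iprod_sub => // t _ ht [u [c [Iu ->]]]; rewrite mulrDr;
  apply: idealD => //; try by rewrite mulrC; apply: KI.
  by rewrite mulrA; apply: idealM.
rewrite mulrCA; apply: idealM => //.
apply: (IH (colon K x)) => //; first exact: colon_ideal.
  by rewrite /colon -exprSr.
move=> s v Is hv; rewrite /colon -mulrA; apply: KI => //.
by apply: iprod_mem => //; apply: adj_mem.
Qed.

(** * Reductions of powers of an ideal *)

Definition reduction I d w := ipow I d w /\
  exists N, Defs.subset (ipow I (N + d)) (mulset w (ipow I N)).

Definition has_reductions I :=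
  exists d0, forall d, (d0 <= d)%N -> exists w, reduction I d w.

(** Multiply the inclusion by I^(M - N). For d > 0, taking [M] a large multiple of [d] shows that wR
    is a reduction of I^d in the usual sense. *)
Lemma reduction_ge I d w : is_ideal I -> reduction I d w ->
  exists N, forall M, (N <= M)%N ->
    Defs.subset (ipow I (M + d)) (mulset w (ipow I M)).
Proof.
move=> hI [_ [N hN]]; exists N => M NM.
have -> : (M + d = (M - N) + (N + d))%N by lia.
apply: ipowD_sub; first by apply: mulset_ideal; apply: ipow_ideal.
move=> u v hu /hN [s hs ->]; exists (u * s); last by ring.
by rewrite -(subnK NM); apply: ipowD_mem.
Qed.

Lemma reductionX I d w : is_ideal I -> reduction I d w ->
  forall n, exists N, forall M, (N <= M)%N ->
    Defs.subset (ipow I (M + d * n)) (mulset (w ^+ n) (ipow I M)).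
Proof.
move=> hI /(reduction_ge hI) [N hN] n; exists N => M NM.
elim: n => [|n IH] t; first by rewrite muln0 addn0 => ht; exists t; rewrite ?mul1r.
have -> : (M + d * n.+1 = (M + d * n) + d)%N by lia.
case/hN => [|s /IH [r hr ->] ->]; first by lia.
by exists r => //; rewrite exprS mulrA.
Qed.

(** A power of [a] lies in w I^N, so [w] divides a nonzerodivisor. *)
Lemma reduction_nzd I d w a : is_ideal I -> I a -> nzd a -> reduction I d w -> nzd w.
Proof.
move=> hI Ia na [_ [N hN]].
have [|s _ e] := hN (a ^+ (N + d)).
  by rewrite -{1}[(N + d)%N]mul1n; apply: ipowX => //; apply: ipow1_mem.
by apply: (@nzd_divl _ s); rewrite -e; apply: nzdX.
Qed.

Lemma princ_has_reductions a : has_reductions (princ a).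
Proof.
exists 0%N => d _; exists (a ^+ d); split.
  rewrite -{1}[d]mul1n; apply: ipowX; first exact: princ_ideal.
  exact: ipow1_mem (princ_mem a).
exists 0%N; elim: d => [|d IH] t; first by exists t; rewrite ?mul1r.
rewrite addnS; apply: iprod_sub t; first exact: mulset_ideal.
move=> _ _ /IH[s _ ->] [r ->].
by exists (s * r) => //; rewrite exprS; ring.
Qed.

Lemma least_nat (P : nat -> Prop) n : P n ->
  exists k, [/\ (k <= n)%N, P k & forall j, (j < k)%N -> ~ P j].
Proof.
elim/ltn_ind: n => n IH Pn.
case: (classic (exists2 j, (j < n)%N & P j)) => [[j jn /(IH _ jn)[k [kj Pk hk]]]|no].
  by exists k; split=> //; lia.
by exists n; split=> // j jn Pj; apply: no; exists j.
Qed.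

(** * Binary forms in y and z *)

Section Forms.
Variables y z : R.

(** Forms are stored dehomogenized: coefficients of [p] beyond [n] are ignored, and a factor X in
    [p] stands for a factor y. *)
Definition bform n (p : {poly R}) : R := \sum_(i < n.+1) p`_i * y ^+ i * z ^+ (n - i).

Lemma bformD n p q : bform n (p + q) = bform n p + bform n q.
Proof. by rewrite -big_split; apply: eq_bigr => i _; rewrite coefD !mulrDl. Qed.

Lemma bformZ n r p : bform n (r *: p) = r * bform n p.
Proof. by rewrite mulr_sumr; apply: eq_bigr => i _; rewrite coefZ !mulrA. Qed.

Lemma bformMX n p : bform n.+1 (p * 'X) = y * bform n p.
Proof.
rewrite /bform big_ord_recl coefMX /= !mul0r add0r mulr_sumr; apply: eq_bigr => i _.
by rewrite coefMX /= subSS exprS; ring.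
Qed.

Lemma bformMXn n k p : bform (n + k) (p * 'X^k) = y ^+ k * bform n p.
Proof.
elim: k => [|k IH]; first by rewrite addn0 expr0 mulr1 mul1r.
by rewrite addnS exprSr mulrA bformMX IH exprS mulrA.
Qed.

Lemma bform1 n : bform n 1 = z ^+ n.
Proof.
rewrite /bform big_ord_recl coef1 /= mul1r expr0 mul1r subn0 big1 ?addr0 // => i _.
by rewrite coef1 /= !mul0r.
Qed.

(** The ideal (y, z)^n; for y a nonzerodivisor, y^n times the polynomials of degree at most [n] in
    z/y. *)
Definition bformset n t := exists p, t = bform n p.

Lemma bformset_ideal n : is_ideal (bformset n).
Proof.
split; first by exists 0; rewrite /bform big1 // => i _; rewrite coef0 !mul0r.
split=> [_ _ [p ->] [q ->]|r _ [p ->]]; first by exists (p + q); rewrite bformD.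
by exists (r *: p); rewrite bformZ.
Qed.

Lemma bformsetM n k t : bformset n t -> bformset (n + k) (y ^+ k * t).
Proof. by move=> [p ->]; exists (p * 'X^k); rewrite bformMXn. Qed.

End Forms.

(** * One-dimensional local rings: primes, socles, Nakayama, chain conditions *)

Section Local.
Variable m : R -> Prop.
Hypothesis hm : CM1_local m.

Let noeth : noetherian R. Proof. by case: hm. Qed.

Lemma m_ideal : is_ideal m.
Proof. by case: hm => _ [[[]]]. Qed.

Lemma m_proper : ~ m 1.
Proof. by case: hm => _ [[[_ []]]]. Qed.

Lemma m_prime : is_prime m.
Proof.
have [_ [[[_ [m1 mmax]] _] _]] := hm.
apply: (@maximal_disjoint_prime (eq 1)) => //.
- by move=> _ _ <- <-; rewrite mulr1.
- exact: m_ideal.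
- by move=> x mx e; apply: m1; rewrite e.
move=> J hJ dJ sJ; have [e x /e //|/dJ[]//] := mmax J hJ sJ.
Qed.

Lemma proper_sub_m I : is_ideal I -> ~ I 1 -> Defs.subset I m.
Proof.
move=> hI nI.
have [|//|M [[hM [nM sM]] maxM]] :=
  @noetherian_max (fun J => is_ideal J /\ ~ J 1 /\ Defs.subset I J) I noeth.
- by move=> J [].
- by split=> //; split.
move=> x Ix; have [_ [[_ uniq] _]] := hm.
apply: (uniq M _ x).1; last exact: sM.
split=> //; split=> // J hJ sMJ; case: (classic (J 1)) => [|nJ]; [by right|left].
move=> y; split; last exact: sMJ.
by apply: maxM => //; split=> //; split=> // t /sM /sMJ.
Qed.

Lemma unit_of_notin_m u : ~ m u -> exists v, v * u = 1.
Proof.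
move=> nu; apply: NNPP => no; apply: nu; apply: (@proper_sub_m (princ u)).
- exact: princ_ideal.
- by move=> [r e]; apply: no; exists r.
exact: princ_mem.
Qed.

Lemma unit_1Bm x : m x -> exists v, v * (1 - x) = 1.
Proof.
move=> mx; apply: unit_of_notin_m => h; apply: m_proper.
by rewrite -(subrK x 1); apply: idealD; [apply: m_ideal| |].
Qed.

(** If [P] were smaller than [m], an ideal maximal among those missing all y^j s with s outside [P]
    would be a prime strictly inside [P]: a chain of three primes. *)
Lemma prime_with_nzd P y : is_prime P -> nzd y -> P y -> P = m.
Proof.
move=> hP ny Py; have [iP [nP1 pP]] := hP.
have sPm := proper_sub_m iP nP1.
apply: same_eq; apply: NNPP => nPm.
have stPm : strict_sub P m.
  split=> //; apply: NNPP => no; apply: nPm => x; split=> [/sPm//|mx].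
  by apply: NNPP => nx; apply: no; exists x.
pose S t := exists j s, ~ P s /\ t = y ^+ j * s.
have [||Q [[iQ dQ] maxQ]] :=
  @noetherian_max (fun J => is_ideal J /\ forall x, J x -> ~ S x) (princ 0) noeth.
- by move=> J [].
- split; first exact: princ_ideal.
  move=> x [r ->] [j [s [ns]]]; rewrite mulr0 => e; apply: ns.
  by rewrite (nzdX (n := j) ny (esym e)); apply: ideal0.
have hQ : is_prime Q.
  apply: (@maximal_disjoint_prime S) => //.
  - by exists 0, 1; rewrite mulr1.
  - move=> _ _ [j [s [ns ->]]] [k [t [nt ->]]].
    by exists (j + k)%N, (s * t); split; [case/pP|rewrite exprD; ring].
  - by move=> J iJ dJ; apply: maxQ.
have [_ [_ [[_ nochain] _]]] := hm; apply: nochain.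
exists Q, P, m; split=> //; split=> //; split; first exact: m_prime.
split=> //; split.
  move=> x Qx; apply: NNPP => nx; apply: dQ Qx _.
  by exists 0, x; rewrite mul1r.
by exists y; split=> // Qy; apply: dQ Qy _; exists 1%N, 1; rewrite mulr1.
Qed.

(** An ideal maximal among the (X : u) with u outside [X] is an associated prime of R/X; it contains
    [y], so it is [m]. *)
Lemma socle_elt X y : is_ideal X -> ~ X 1 -> nzd y -> X y ->
  exists u, ~ X u /\ forall r, m r -> X (r * u).
Proof.
move=> iX nX ny Xy.
have [||P [[u [nu eP]] maxP]] :=
  @noetherian_max (fun J => exists u, ~ X u /\ J = colon X u) (colon X 1) noeth.
- by move=> J [u [_ ->]]; apply: colon_ideal.
- by exists 1.
have pP : is_prime P.
  rewrite eP; split; first exact: colon_ideal.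
  split; first by rewrite /colon mul1r.
  move=> a b cab; apply: NNPP => /not_or_and[na nb]; apply: nb.
  rewrite -eP; apply: (maxP (colon X (a * u))); first by exists (a * u).
    by move=> t; rewrite eP /colon mulrCA => ?; apply: idealM.
  by rewrite /colon mulrA [b * a]mulrC.
exists u; split=> // r mr; have <- : P r = X (r * u) by rewrite eP.
rewrite (prime_with_nzd pP ny) // eP /colon mulrC.
exact: idealM.
Qed.

(** The hypothesis encodes that [L] lies in X + mL without forming that sum. If [Z] is maximal among
    the ideals containing [X] but not [L], and r l were outside [Z], then l = u + c r l with u in
    [Z], and 1 - c r is a unit, so l would lie in [Z]. *)
Lemma nakayama X L : is_ideal X ->
  (forall Z, is_ideal Z -> Defs.subset X Z ->
     (forall r l, m r -> L l -> Z (r * l)) -> Defs.subset L Z) ->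
  Defs.subset L X.
Proof.
move=> iX hL; apply: NNPP => nLX.
have [||Z [[iZ [sXZ nLZ]] maxZ]] := @noetherian_max
  (fun Z => is_ideal Z /\ Defs.subset X Z /\ ~ Defs.subset L Z) X noeth.
- by move=> J [].
- by split=> //; split.
apply: nLZ; apply: hL => // r l mr Ll; apply: NNPP => nZ.
have [u [c [Zu el]]] : adj Z (r * l) l.
  apply: NNPP => nl; apply: nZ; apply: (maxZ (adj Z (r * l))).
  - split; first exact: adj_ideal.
    split; first by move=> t /sXZ; apply: adj_sub.
    by move/(_ l Ll).
  - exact: adj_sub.
  - exact: adj_mem.
have [|v ev] := unit_1Bm (x := c * r); first by apply: idealM => //; apply: m_ideal.
apply: nZ; have -> : r * l = (r * v) * u; last exact: idealM.
have -> : u = l - c * (r * l) by rewrite {1}el addrK.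
by rewrite -[LHS]mul1r -ev; ring.
Qed.

(** This is the finite length of R/yR. Instead of counting lengths, take an ideal X maximal among
    those containing [y] on which the chain becomes constant; if X is proper, a socle element of R/X
    enlarges it. *)
Lemma dcc_above_nzd y (J : nat -> R -> Prop) :
  nzd y -> (forall n, is_ideal (J n)) -> (forall n, J n y) ->
  (forall n, Defs.subset (J n.+1) (J n)) ->
  exists k, forall n, (k <= n)%N -> Defs.subset (J k) (J n).
Proof.
move=> ny iJ yJ decJ.
have decr n k : (n <= k)%N -> Defs.subset (J k) (J n).
  by move/subnK <-; elim: (k - n)%N => [//|d IH] x; rewrite addSn => /decJ /IH.
pose stab X (t : nat) := forall n, (t <= n)%N -> forall x, X x -> J t x -> J n x.
have [||X [[iX [yX [t st]]] maxX]] := @noetherian_max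
  (fun X => is_ideal X /\ X y /\ exists k, stab X k) (princ y) noeth.
- by move=> X [].
- split; first exact: princ_ideal.
  split; first exact: princ_mem.
  by exists 0 => n _ _ [r ->] _; apply: idealM.
suff X1 : X 1.
  by exists t => n tn x; apply: st => //; rewrite -[x]mulr1; apply: idealM.
apply: NNPP => nX1; have [u [nu mu]] := socle_elt iX nX1 ny yX.
apply: nu; apply: (maxX (adj X u)); [|exact: adj_sub|exact: adj_mem].
split; first exact: adj_ideal.
split; first exact: adj_sub.
(* If every [J n] meets the coset u + X, subtracting a multiple of a common element reduces to X. If
   some [J n0] misses it, then in later terms c u lies in X, as c cannot be a unit. *)
case: (classic (forall n, exists2 v, J n v & X (v - u))) => [all|].
  exists t => n tn _ [x0 [c [Xx0 ->]]] Jx.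
  have [v Jv Xvu] := all n.
  have -> : x0 + c * u = (x0 - c * (v - u)) + c * v by ring.
  apply: idealD => //; last exact: idealM.
  apply: st => //; first by apply: idealB => //; apply: idealM.
  have -> : x0 - c * (v - u) = x0 + c * u - c * v by ring.
  by apply: idealB => //; apply: idealM => //; apply: (decr t n).
move/not_all_ex_not=> [n0 no].
exists (maxn t n0) => n; rewrite geq_max => /andP[tn _] _ [x0 [c [Xx0 ->]]] Jx.
apply: st => //; last by apply: decr Jx; apply: leq_maxl.
apply: idealD => //; apply: NNPP => nXcu.
have [|v ev] := unit_of_notin_m (u := c); first by move/mu.
apply: no; exists (v * (x0 + c * u)).
  by apply: idealM => //; apply: decr Jx; apply: leq_maxr.
have -> : v * (x0 + c * u) - u = v * x0 + (v * c) * u - u by ring.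
by rewrite ev mul1r addrK; apply: idealM.
Qed.

(** * Existence of reductions in all large degrees *)

Ltac ring_exp := rewrite ?(exprD, exprS, expr0); ring.

(* The Krull-Akizuki argument for B = R[z/y]: the element b/y^j of B with
   b a form of degree j is represented by the pair (b, j). *)
Lemma unit_relation y z : nzd y -> m y ->
  exists n p, bform y z n p = 0 /\ exists2 i, (i <= n)%N & ~ m p`_i.
Proof.
move=> ny my; pose B := bformset y z.
have iB n : is_ideal (B n) by apply: bformset_ideal.
have BM n k t : B n t -> B (n + k)%N (y ^+ k * t) by apply: bformsetM.
(* With denominators cleared, [J n] is yR plus the intersection of R with y^n R[z/y]. *)
pose J n r := exists j b c, B j b /\ y ^+ j * r = y ^+ n * b + y ^+ j.+1 * c.
have [|||t stJ] := @dcc_above_nzd y J ny.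
- move=> n; split.
    by exists 0, 0, 0; split; [apply: ideal0|ring_exp].
  split=> [r1 r2 [j1 [b1 [c1 [B1 e1]]]] [j2 [b2 [c2 [B2 e2]]]]|r r1 [j [b [c [Bb e]]]]].
    exists (j1 + j2)%N, (y ^+ j2 * b1 + y ^+ j1 * b2), (c1 + c2); split.
      by apply: idealD => //; [apply: BM|rewrite addnC; apply: BM].
    transitivity (y ^+ j2 * (y ^+ j1 * r1) + y ^+ j1 * (y ^+ j2 * r2)); first by ring_exp.
    by rewrite e1 e2; ring_exp.
  exists j, (r * b), (r * c); split; first exact: idealM.
  by rewrite mulrCA e; ring_exp.
- move=> n; exists 0, 0, 1; split; first exact: ideal0.
  by ring_exp.
- move=> n r [j [b [c [Bb e]]]]; exists j, (y * b), c; split; first exact: idealM.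
  by rewrite e; ring_exp.
(* For b/y^j in R[z/y], this puts y^t b/y^j in R + y^(t+1) R[z/y], by induction on the excess [d] of
   its denominator over y^t. *)
have decomp d : forall j b r, B j b -> y ^+ (t + d) * b = y ^+ j * r ->
  exists r' j' b', B j' b' /\
    y ^+ (t + j') * b = y ^+ (j + j') * r' + y ^+ (t + j + 1) * b'.
  elim: d => [|d IH] j b r Bb e.
    exists r, 0, 0; split; first exact: ideal0.
    by rewrite !addn0 mulr0 addr0 -e addn0.
  (* Stability gives r = y^(t+d+2) b1/y^j1 + y c, so subtracting y b1/y^j1 from b/y^j lowers the
     excess by one. *)
  have Jr : J (t + d.+2)%N r.
    apply: stJ; first exact: leq_addr.
    suff: J (t + d.+1)%N r.
      elim: (d.+1) => [|k IHk]; first by rewrite addn0.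
      rewrite addnS => - [j1 [b1 [c1 [B1 e1]]]]; apply: IHk.
      exists j1, (y * b1), c1; split; first exact: idealM.
      by rewrite e1; ring_exp.
    exists j, b, 0; split=> //; by rewrite -e; ring_exp.
  have [j1 [b1 [c [B1 e1]]]] := Jr.
  pose b2 := y ^+ j1 * b - y ^+ j.+1 * b1.
  have B2 : B (j + j1)%N b2.
    apply: idealB => //; first exact: BM.
    by rewrite exprS -mulrA; apply: idealM => //; rewrite addnC; apply: BM.
  have e2 : y ^+ (t + d) * b2 = y ^+ (j + j1) * c.
    apply: (nzd_cancel ny).
    transitivity (y ^+ j1 * (y ^+ (t + d.+1) * b) - y ^+ j * (y ^+ (t + d.+2) * b1)).
      by rewrite /b2 !addnS; ring_exp.
    transitivity (y ^+ j * (y ^+ j1 * r - y ^+ (t + d.+2) * b1)).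
      by rewrite e; ring_exp.
    by rewrite e1; ring_exp.
  have [r' [j' [b' [B' e']]]] := IH _ _ _ B2 e2.
  exists r', (j' + j1)%N, (y ^+ j1 * b' + y ^+ j' * b1); split.
    by apply: idealD => //; [apply: BM|rewrite addnC; apply: BM].
  transitivity (y ^+ (t + j') * b2 + y ^+ (t + j' + j.+1) * b1).
    by rewrite /b2; ring_exp.
  by rewrite e'; ring_exp.
(* [A n] consists of the r in R of the form y^t b/y^n. This increasing chain stops at some D, which
   bounds the degree in z/y needed for elements of R in y^t R[z/y]. *)
pose A n r := exists b, B n b /\ y ^+ n * r = y ^+ t * b.
have iA n : is_ideal (A n).
  split; first by exists 0; split; [apply: ideal0|rewrite !mulr0].
  split=> [r s [b [Bb e]] [c [Bc e']]|r s [b [Bb e]]].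
    by exists (b + c); split; [apply: idealD|rewrite !mulrDr e e'].
  by exists (r * b); split; [apply: idealM|rewrite mulrCA e; ring_exp].
have AM n k : Defs.subset (A n) (A (n + k)%N).
  move=> r [b [Bb e]]; exists (y ^+ k * b); split; first exact: BM.
  by rewrite mulrCA -e; ring_exp.
have [||_ [[D ->] maxA]] := @noetherian_max (fun X => exists n, X = A n) (A 0%N) noeth.
- by move=> X [n ->].
- by exists 0%N.
have AD n : Defs.subset (A n) (A D).
  move=> r Ar; apply: (maxA (A (n + D)%N)); [by exists (n + D)%N| |exact: AM].
  by rewrite addnC; apply: AM.
have Bz : B D.+1 (z ^+ D.+1) by exists 1; rewrite bform1.
have [|r [j [b [Bb e]]]] := decomp D.+1 _ _ (y ^+ t * z ^+ D.+1) Bz.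
  by ring_exp.
have [b0 [[p0 eb0] e0]] : A D r.
  apply: (AD (D.+1 + j)%N); exists (y ^+ j * z ^+ D.+1 - y ^+ D.+2 * b); split.
    apply: idealB => //; first exact: BM.
    by rewrite exprS -mulrA; apply: idealM => //; rewrite addnC; apply: BM.
  rewrite mulrBr mulrA -exprD e; ring_exp.
have [p eb] := Bb.
(* This clears denominators in (z/y)^(D+1) = b0/y^D + y b/y^j. Since D + 1 exceeds the degree of b0,
   [p0] enters only from index j + 1 on, and the coefficient at [j] is 1 minus a multiple of y. *)
exists (j + D.+1)%N, ('X^j - p0 * 'X^(j.+1) - y *: (p * 'X^(D.+1))); split.
  rewrite -!scaleN1r !bformD !bformZ.
  have -> : bform y z (j + D.+1) 'X^j = y ^+ j * z ^+ D.+1.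
    by rewrite -['X^j]mul1r addnC bformMXn bform1.
  rewrite bformMXn -eb; have -> : (j + D.+1 = D + j.+1)%N by lia.
  rewrite bformMXn -eb0.
  apply: (nzdX (n := t) ny).
  transitivity (y ^+ (t + j) * z ^+ D.+1 - y ^+ (j.+1) * (y ^+ t * b0) - y ^+ (t + D.+2) * b).
    by ring_exp.
  by rewrite -e0 e; ring_exp.
exists j; first exact: leq_addr.
rewrite !coefB coefXn eqxx coefMXn ltnSn subr0 coefZ.
move=> h; apply: m_proper; rewrite -(subrK (y * (p * 'X^(D.+1))`_j) 1).
have im := m_ideal; apply: idealD => //; exact: ideal_mulr.
Qed.

(* A relation P(y, z) = 0 between a reduction y of I and z = x^k, whose first
   unit coefficient has index a, reads y^a P' = 0 modulo m with P' = c z^s mod y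
   and c a unit. Then w = y_d + x^(d - k s) P' is a reduction of I + xR, where y_d is
   a reduction of I in degree d: modulo w and m, the equation for y^a P' makes
   y^a y_d vanish, so I is nilpotent, and then so is x. As y_d exists in every
   large degree, no assumption on the residue field is needed. *)
Lemma adj_has_reductions I a0 x : is_ideal I -> Defs.subset I m ->
  I a0 -> nzd a0 -> has_reductions I -> has_reductions (adj I x).
Proof.
move=> hI sIm Ia0 na0 [d0 red].
have iI' := adj_ideal x hI; set I' := adj I x in iI' *.
have sI n t : ipow I n t -> ipow I' n t.
  by apply: ipow_mono => // u; apply: adj_sub.
have iP n : is_ideal (ipow I' n) by apply: ipow_ideal.
have xI' n : ipow I' n (x ^+ n).
  rewrite -{1}[n]mul1n; apply: ipowX => //; apply: ipow1_mem; exact: adj_mem.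
(* A positive degree, so that y lies in [I] and hence in [m]. *)
pose k := d0.+1.
have [y yred] := red k (leqnSn d0).
have ny := reduction_nzd hI Ia0 na0 yred.
have Iy : ipow I k y := yred.1.
have my : m y by apply: sIm; apply: ipowS_sub Iy.
have yzI' i j : ipow I' (k * (i + j)) (y ^+ i * (x ^+ k) ^+ j).
  by rewrite mulnDr; apply: ipowD_mem => //; apply: ipowX => //; apply: sI.
have [n [p [rel [i0 i0n nmi0]]]] := unit_relation (x ^+ k) ny my.
have [a [ai0 nma lowm]] := least_nat (P := fun i => ~ m p`_i) nmi0.
have [s en] : exists s, n = (a + s)%N by exists (n - a)%N; lia.
move: rel; rewrite /bform en -addnS big_split_ord /=.
set low := \sum_(i < a) _.
under eq_bigr => i _ do rewrite exprD subnDl.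
set P' := \sum_(i < s.+1) p`_(a + i) * y ^+ i * (x ^+ k) ^+ (s - i).
have -> : \sum_(i < s.+1) p`_(a + i) * (y ^+ a * y ^+ i) * (x ^+ k) ^+ (s - i)
          = y ^+ a * P'.
  by rewrite mulr_sumr; apply: eq_bigr => i _; ring.
move=> rel.
have P'I : ipow I' (k * s) P'.
  apply: ideal_sum_ord => // i; rewrite -mulrA; apply: idealM => //.
  by rewrite -{1}(subnKC (n := s) (m := i)) // -ltnS.
have [v0 ev0] := unit_of_notin_m nma.
(* Then the subtraction d - k s is exact, and d > d0 provides [yd] and makes d positive. *)
exists (k + k * s)%N => d hd.
have [|yd ydred] := red d; first by rewrite /k in hd; lia.
pose w := yd + x ^+ (d - k * s) * P'.
exists w; split.
  apply: idealD => //; first by apply: sI; case: ydred.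
  have {1}-> : d = (d - k * s + k * s)%N by lia.
  exact: ipowD_mem.
have [N1 hN1] := reductionX hI yred a.
have [N2 hN2] := reduction_ge hI ydred.
(* [M0] leaves room to extract first [yd] and then y^a from I^M0. *)
pose M := (N1 + N2)%N; pose M0 := (M + k * a + d)%N.
exists M0.
apply: nakayama; first exact: mulset_ideal.
move=> Z iZ sXZ mLZ.
have Zw q t : (q + d = M0 + d)%N -> ipow I' q t -> Z (w * t).
  by move=> /addIn -> ht; apply: sXZ; exists t.
(* Factors of [I'] are traded for factors of [I]. At e = 0 the element u is a multiple of yd y^a,
   which is y^a w - x^(d - k s) y^a P', where -y^a P' = [low] has coefficients in [m]. *)
suff H e j u v : (j + e = M0)%N -> ipow I j u -> ipow I' (e + d) v -> Z (v * u).
  by move=> v hv; rewrite -[v]mulr1; apply: (H M0 0%N).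
elim: e j u v => [|e IH] j u v ej hu hv.
  move: hu; rewrite addn0 in ej; rewrite ej /M0 => /hN2[|u1].
    by rewrite /M; lia.
  case/hN1 => [|u' hu' -> ->]; first by rewrite /M; lia.
  have -> : v * (yd * (y ^+ a * u')) = w * (y ^+ a * u' * v)
      + low * (x ^+ (d - k * s) * u' * v).
    have -> : low = - (y ^+ a * P') by apply/eqP; rewrite -addr_eq0 rel.
    by rewrite /w; ring.
  apply: idealD => //.
    apply: (Zw (k * a + M + d)%N); first by rewrite /M0; lia.
    apply: ipowD_mem => //; apply: ipowD_mem => //; last exact: sI.
    by apply: ipowX => //; apply: sI.
  rewrite mulr_suml; apply: ideal_sum_ord => // i.
  rewrite -!mulrA; apply: mLZ.
    by apply: NNPP; apply: lowm.
  have -> : (M0 + d = k * (i + (a + s - i)) + (d - k * s + (M + d)))%N.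
    have ia := ltn_ord i.
    have -> : (i + (a + s - i) = a + s)%N by lia.
    by rewrite /M0 mulnDr; lia.
  rewrite mulrA; apply: ipowD_mem => //; apply: ipowD_mem => //.
  by apply: ipowD_mem => //; apply: sI.
(* A factor in a positive power of [I] releases one element of [I] to join u, so the induction
   hypothesis applies with j + 1. *)
have step q y' (r : nat) t : (q.+1 + r + j = M0 + d)%N -> ipow I q.+1 y' ->
    ipow I' r t -> Z (y' * t * u).
  move=> er hy' ht; rewrite -mulrA.
  apply: (@iprod_sub _ _ (colon Z (t * u)) _ _ y' hy'); first exact: colon_ideal.
  move=> v1 u1 hv1 hu1; rewrite /colon.
  have -> : v1 * u1 * (t * u) = (v1 * t) * (u * u1) by ring.
  apply: (IH j.+1); first by lia.
    by apply: iprod_mem.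
  have -> : (e + d = q + r)%N by lia.
  by apply: ipowD_mem => //; apply: sI.
(* Only the pure power of x needs work: with the unit coefficient of index [a], p_a x^d equals w
   minus yd minus terms divisible by y, and [step] absorbs the last two. *)
apply: (@ipow_adj_sub I (colon Z u) x (e + d)) => //; first exact: colon_ideal.
  rewrite /colon.
  have exd : v0 * (p`_a * x ^+ d) = x ^+ d by rewrite mulrA ev0 mul1r.
  have -> : x ^+ (e + d).+1 * u = v0 * (p`_a * x ^+ d * (x ^+ e.+1 * u)).
    by rewrite -addSn exprD -{1}exd; ring.
  apply: idealM => //.
  have eP : P' = p`_a * (x ^+ k) ^+ s +
      \sum_(i < s) y * (p`_(a + i.+1) * (y ^+ i * (x ^+ k) ^+ (s - i.+1))).
    rewrite /P' big_ord_recl addn0 subn0 expr0 mulr1; congr (_ + _).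
    by apply: eq_bigr => i _; rewrite !lift0 exprS; ring.
  have -> : p`_a * x ^+ d * (x ^+ e.+1 * u) = w * (x ^+ e.+1 * u) - yd * x ^+ e.+1 * u
      - \sum_(i < s) p`_(a + i.+1) *
          (y * (x ^+ (d - k * s) * (y ^+ i * (x ^+ k) ^+ (s - i.+1)) * x ^+ e.+1) * u).
    have -> : x ^+ d = x ^+ (d - k * s) * (x ^+ k) ^+ s.
      by rewrite -exprM -exprD; congr (_ ^+ _); lia.
    have -> : \sum_(i < s) p`_(a + i.+1) *
          (y * (x ^+ (d - k * s) * (y ^+ i * (x ^+ k) ^+ (s - i.+1)) * x ^+ e.+1) * u)
      = x ^+ (d - k * s) * x ^+ e.+1 * u * (P' - p`_a * (x ^+ k) ^+ s).
      rewrite eP [_ + \sum_(i < s) _]addrC addrK mulr_sumr.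
      by apply: eq_bigr => i _; ring.
    by rewrite /w; ring.
  apply: idealB => //; first apply: idealB => //.
  - apply: (Zw (e.+1 + j)%N); first by lia.
    by apply: ipowD_mem => //; apply: sI.
  - have [ydI _] := ydred.
    have ed : d = d.-1.+1 by rewrite /k in hd; lia.
    rewrite ed in ydI.
    by apply: (step d.-1 _ e.+1) => //; lia.
  apply: ideal_sum_ord => // i; apply: idealM => //.
  apply: (step d0 _ (d - k * s + k * (i + (s - i.+1)) + e.+1)%N) => //.
    have es : (k * s = k * (i + (s - i.+1)) + k)%N.
      by rewrite -mulnSr; congr (k * _)%N; have := ltn_ord i; lia.
    by rewrite -/k; lia.
  apply: ipowD_mem => //; apply: ipowD_mem => //.
move=> u1 v1 hu1 hv1; rewrite /colon.
have -> : u1 * v1 * u = v1 * (u * u1) by ring.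
by apply: (IH j.+1); [lia|apply: iprod_mem|].
Qed.

(** Noetherian induction starting from aR: a largest ideal inside [I] that contains a and has
    reductions absorbs every x in [I]. *)
Lemma regular_has_reductions I : is_ideal I -> regular I -> Defs.subset I m ->
  has_reductions I.
Proof.
move=> hI [a [Ia na]] sIm.
have [||X [[iX [sXI [Xa redX]]] maxX]] := @noetherian_max
  (fun X => is_ideal X /\ Defs.subset X I /\ X a /\ has_reductions X) (princ a) noeth.
- by move=> X [].
- split; first exact: princ_ideal.
  split; first by move=> _ [r ->]; apply: idealM.
  by split; [apply: princ_mem|apply: princ_has_reductions].
suff <- : X = I by [].
apply: same_eq => x; split=> [/sXI//|Ix].
apply: (maxX (adj X x)); [|exact: adj_sub|exact: adj_mem].
split; first exact: adj_ideal.
split; first by move=> _ [u [c [/sXI Iu ->]]]; apply: idealD => //; apply: idealM.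
split; first exact: adj_sub.
by apply: (adj_has_reductions (a0 := a)) => // t /sXI /sIm.
Qed.

(** * Stable ideals are principal over their endomorphism rings *)

(* I = x (I : I) *)
Definition self_gen I x :=
  [/\ I x, nzd x & forall u v, I u -> I v -> exists2 t, I t & u * v = x * t].

(* With A = (I : I), stability gives I^d A = w A and I^(d+1) A = w' A for reductions
   w, w' of consecutive degrees, so that I = (w'/w) A. *)
Lemma stable_principal I : is_ideal I -> regular I -> stable I ->
  exists x, self_gen I x.
Proof.
move=> hI rI [_ [_ stI]]; case: (classic (I 1)) => [I1|nI1].
  exists 1; split=> //; first exact: nzd1.
  by move=> u v Iu Iv; exists (u * v); rewrite ?mul1r //; apply: idealM.
have [d0 red] := regular_has_reductions hI rI (proper_sub_m hI nI1).
have wP d : (d0 <= d)%N -> exists w, [/\ ipow I d w, nzd w &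
    forall t u, ipow I d t -> I u -> exists2 v, I v & t * u = w * v].
  move=> /red [w redw]; have [a [Ia na]] := rI.
  have nw := reduction_nzd hI Ia na redw.
  exists w; split=> //; first by case: redw.
  have [N hN] := reduction_ge hI redw.
  move=> t u ht hu; have [|v [hv e]] := stI t w nw _ u hu; last by exists v.
  (* Here t I^(N+1) lies in I^(N+1+d), hence in w I^(N+1), so t/w is in B(I); N + 1 supplies the
     positive exponent that [stable] asks for. *)
  exists N.+1; split=> // r hr.
  have [|s hs e] := hN N.+1 (leqnSn _) (t * r); last by exists s.
  by rewrite mulrC; apply: ipowD_mem.
have [w [Iw nw hw]] := wP d0 (leqnn _).
have [w' [Iw' nw' hw']] := wP d0.+1 (leqnSn _).
(* I^(d0+1) = I^d0 I lies in w I, so the quotient w'/w is an element x of [I]. *)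
have [x Ix ew'] : mulset w I w'.
  apply: iprod_sub Iw'; first exact: mulset_ideal.
  by move=> t u ht hu; have [v Iv ->] := hw t u ht hu; exists v.
exists x; split=> //; first by apply: (@nzd_divl _ w); rewrite mulrC -ew'.
move=> u v Iu Iv; have [t It e] := hw' (w * u) v (iprod_mem Iw Iu) Iv.
exists t => //; apply: (nzd_cancel nw).
by rewrite !mulrA e ew'.
Qed.

End Local.

(** * Homomorphisms between ideals and trace ideals *)

Section Homs.

Definition linear_on I (f : R -> R) :=
  (forall x y, I x -> I y -> f (x + y) = f x + f y) /\
  (forall r x, I x -> f (r * x) = r * f x).

(** Brings a map linear on [I] to the normal form demanded by [Hom]. *)
Definition restr I (f : R -> R) x :=
  if excluded_middle_informative (I x) then f x else 0.

Lemma restrE I f x : I x -> restr I f x = f x.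
Proof. by rewrite /restr; case: excluded_middle_informative. Qed.

Lemma restr_out I f x : ~ I x -> restr I f x = 0.
Proof. by rewrite /restr; case: excluded_middle_informative. Qed.

Lemma restr_Hom I J f : is_ideal I -> linear_on I f ->
  (forall x, I x -> J (f x)) -> Defs.Hom I J (restr I f).
Proof.
move=> hI [fD fM] fJ; split; first by move=> x Ix; rewrite restrE //; apply: fJ.
split; first by move=> x y Ix Iy; rewrite !restrE ?fD //; apply: idealD.
split; first by move=> r x Ix; rewrite !restrE ?fM //; apply: idealM.
by move=> x /restr_out.
Qed.

Lemma Hom_linear I J f : Defs.Hom I J f -> linear_on I f.
Proof. by case=> _ [? [? _]]. Qed.

(** Both sides are f(xy). Hence f is multiplication by the fraction f(x)/x when x is a
    nonzerodivisor. *)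
Lemma Hom_swap I J f x y : Defs.Hom I J f -> I x -> I y -> x * f y = y * f x.
Proof. by move=> /Hom_linear[_ fM] Ix Iy; rewrite -!fM // mulrC. Qed.

Lemma Hom_inj I J J' f g x : Defs.Hom I J f -> Defs.Hom I J' g -> I x -> nzd x -> f x = g x ->
  f = g.
Proof.
move=> hf hg Ix nx e; apply: functional_extensionality => u.
case: (classic (I u)) => Iu; last by case: hf hg => _ [_ [_ ->]] // [_ [_ [_ ->]]].
by apply: (nzd_cancel nx); rewrite (Hom_swap hf) // (Hom_swap hg) // e.
Qed.

(* The quotient a / x, meaningful only if x is a nonzerodivisor dividing a. *)
Definition quo x a := epsilon (inhabits 0) (fun t => a = x * t).

Lemma quoK x a : (exists t, a = x * t) -> a = x * quo x a.
Proof. exact: epsilon_spec. Qed.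

Lemma quoE x t : nzd x -> quo x (x * t) = t.
Proof. by move=> nx; apply: (nzd_cancel nx); rewrite -quoK //; exists t. Qed.

Lemma quo_linear I x f : nzd x -> linear_on I f ->
  (forall u, I u -> exists t, f u = x * t) -> linear_on I (fun u => quo x (f u)).
Proof.
move=> nx [fD fM] fx; split=> [u v Iu Iv|r u Iu].
  by rewrite fD // (quoK (fx u Iu)) (quoK (fx v Iv)) -mulrDr !quoE.
by rewrite fM // (quoK (fx u Iu)) mulrCA !quoE.
Qed.

Lemma tr_mem K f x : Defs.Hom K (fun _ => True) f -> K x -> tr K (f x).
Proof. by move=> hf Kx; exists [:: (f, x)]; rewrite big_ord1; split=> // [[]]. Qed.

Lemma tr_sub K L : is_ideal L ->
  (forall f x, Defs.Hom K (fun _ => True) f -> K x -> L (f x)) -> Defs.subset (tr K) L.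
Proof.
move=> hL h _ [s [hs ->]]; apply: ideal_sum_ord => // i.
by have [hf hx] := hs i (ltn_ord i); apply: h.
Qed.

(** The form in which (R : I) = (I : I) is used: values of functionals on [I] lie in tr(I) = I. *)
Lemma trace_linear I f x : trace_ideal I -> linear_on I f -> I x -> I (f x).
Proof.
move=> [hI trI] lf Ix; rewrite -(restrE f Ix); apply: (trI _).1.
by apply: tr_mem => //; apply: restr_Hom.
Qed.

(** The elements of IJ sent into [L] by a functional form an ideal, so testing products uv
    suffices. *)
Lemma tr_iprod_sub I J L : is_ideal I -> is_ideal L ->
  (forall f u v, linear_on (iprod I J) f -> I u -> J v -> L (f (u * v))) ->
  Defs.subset (tr (iprod I J)) L.
Proof.
move=> hI hL h; apply: tr_sub => // f p /Hom_linear lf.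
have iP := iprod_ideal J hI; have [fD fM] := lf.
suff: Defs.subset (iprod I J) (fun p => iprod I J p /\ L (f p)) by move=> H /H[].
apply: iprod_sub; last by move=> u v Iu Jv; split; [apply: iprod_mem|apply: h].
split.
  by split; [apply: ideal0|rewrite -(mulr0 0) fM ?mul0r; apply: ideal0].
split=> [q r [Pq Lq] [Pr Lr]|r q [Pq Lq]].
  by split; [apply: idealD|rewrite fD //; apply: idealD].
by split; [apply: idealM|rewrite fM //; apply: idealM].
Qed.

Lemma self_gen_quo I x u v : self_gen I x -> I u -> I v -> exists t, u * v = x * t.
Proof. by move=> [_ _ h] Iu Iv; have [t _ ->] := h u v Iu Iv; exists t. Qed.

Lemma mul_linear I v f : linear_on I f -> linear_on I (fun u => f u * v).
Proof. by move=> [fD fM]; split=> [x y|r x] *; rewrite ?fD ?fM //; ring. Qed.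

(** * Two trace ideals I = x(I : I) and J = y(J : J) *)

Section Pair.
Variables (I J : R -> Prop) (x y : R).
Hypotheses (hI : is_ideal I) (hJ : is_ideal J).
Hypotheses (trI : trace_ideal I) (trJ : trace_ideal J).
Hypotheses (gx : self_gen I x) (gy : self_gen J y).

Let Ix : I x. Proof. by case: gx. Qed.
Let Jy : J y. Proof. by case: gy. Qed.
Let nx : nzd x. Proof. by case: gx. Qed.
Let ny : nzd y. Proof. by case: gy. Qed.

(* In Q(R) this sends multiplication by q to multiplication by q x / y. *)
Definition twist f := restr J (fun v => quo y (f x * v)).

(** Division by [y] is possible because JJ lies in yJ. For fixed v in [J], u -> f(u) v / y is a
    functional on the trace ideal [I], so its value at [x] lies in [I]. *)
Lemma twist_Hom f : Defs.Hom I J f -> Defs.Hom J I (twist f).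
Proof.
move=> hf; have [fJ [_ [_ _]]] := hf; apply: restr_Hom => //.
  apply: quo_linear => // [|v Jv]; last by apply: (self_gen_quo gy) => //; apply: fJ.
  by split=> [u v|r u] *; ring.
move=> v Jv; apply: (trace_linear (f := fun u => quo y (f u * v))) => //.
apply: quo_linear => //; first exact: mul_linear (Hom_linear hf).
by move=> u Iu; apply: (self_gen_quo gy) => //; apply: fJ.
Qed.

Lemma twist_gen f : twist f y = f x.
Proof. by rewrite /twist restrE // mulrC quoE. Qed.

(** g(uv) = u g(v) lies in II, hence in xI, so p -> g(p)/x is a functional on IJ; its value at xy is
    g(y). *)
Lemma Hom_eval_tr g : Defs.Hom J I g -> tr (iprod I J) (g y).
Proof.
move=> hg; have [gI [gD [gM _]]] := hg.
have iP := iprod_ideal J hI.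
have sub : Defs.subset (iprod I J) (fun p => J p /\ exists t, g p = x * t).
  apply: iprod_sub.
    split.
      split; first exact: ideal0.
      by exists 0; rewrite -(mulr0 0) gM ?mul0r ?mulr0 //; apply: ideal0.
    split=> [p q [Jp [s es]] [Jq [t et]]|r p [Jp [s es]]].
      by split; [apply: idealD|exists (s + t); rewrite gD // es et mulrDr].
    by split; [apply: idealM|exists (r * s); rewrite gM // es mulrCA].
  move=> u v Iu Jv; split; first exact: idealM.
  by rewrite gM //; apply: (self_gen_quo gx) => //; apply: gI.
have Pxy : iprod I J (x * y) by apply: iprod_mem.
have <- : restr (iprod I J) (fun p => quo x (g p)) (x * y) = g y.
  by rewrite restrE // gM // quoE.
apply: tr_mem => //; apply: restr_Hom => //; apply: quo_linear => //; last by move=> p /sub[].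
by split=> [p q /sub[Jp _] /sub[Jq _]|r p /sub[Jp _]]; [apply: gD|apply: gM].
Qed.

Lemma Hom_with_value w : (forall v, J v -> exists2 t, I t & w * v = y * t) ->
  exists g, Defs.Hom J I g /\ g y = w.
Proof.
move=> hw; exists (restr J (fun v => quo y (w * v))); split; last first.
  by rewrite restrE // mulrC quoE.
apply: restr_Hom => //.
  apply: quo_linear => // [|v /hw[t _ ->]]; last by exists t.
  by split=> [u v|r u] *; ring.
by move=> v /hw[t It ->]; rewrite quoE.
Qed.

(** For w = f(uv'), write v v' = y t with t in [J]; then w v = y f(ut), and u -> f(ut) is a
    functional on the trace ideal [I]. *)
Lemma tr_iprod_colon w v : tr (iprod I J) w -> J v -> exists2 t, I t & w * v = y * t.
Proof.
move=> + Jv; move: w; apply: tr_iprod_sub => //.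
  split; first by exists 0; [apply: ideal0|ring].
  split=> [w1 w2 [t1 It1 e1] [t2 It2 e2]|r w [t It e]].
    by exists (t1 + t2); [apply: idealD|rewrite mulrDl e1 e2 mulrDr].
  by exists (r * t); [apply: idealM|rewrite -mulrA e mulrCA].
move=> f u v' [fD fM] Iu Jv'; have [_ _ /(_ v v' Jv Jv')[t Jt e]] := gy.
exists (f (u * t)); last first.
  rewrite mulrC -!fM; [|exact: iprod_mem..].
  by congr f; rewrite mulrCA e mulrCA.
apply: (trace_linear (f := fun u => f (u * t))) => //.
split=> [u1 u2 I1 I2|r u1 I1]; first by rewrite mulrDl fD //; apply: iprod_mem.
by rewrite -mulrA fM //; apply: iprod_mem.
Qed.

Lemma Hom_iso_tr : iso_HI J I (tr (iprod I J)).
Proof.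
exists (fun g => g y); split; first exact: Hom_eval_tr.
split; first by move=> f g hf hg; apply: (Hom_inj hf hg).
split=> // w hw.
by apply: Hom_with_value => v; apply: tr_iprod_colon.
Qed.

(** A functional on IJ with one factor fixed is a functional on [I] or on [J], so its values lie in
    both. Conversely, for v in [J] the functional k -> k v / y on the intersection keeps it stable,
    so for w in it v -> w v / y is a map from [J] to [I] with value w at [y]. *)
Lemma tr_iprod_icap : trace_ideal (icap I J) -> tr (iprod I J) = icap I J.
Proof.
move=> trK; have [hK _] := trK; apply: same_eq => w; split.
  move: w; apply: tr_iprod_sub => // f u v [fD fM] Iu Jv; split.
    apply: (trace_linear (f := fun u => f (u * v))) => //.
    split=> [u1 u2 I1 I2|r u1 I1]; first by rewrite mulrDl fD //; apply: iprod_mem.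
    by rewrite -mulrA fM //; apply: iprod_mem.
  apply: (trace_linear (f := fun v => f (u * v))) => //.
  split=> [v1 v2 J1 J2|r v1 J1]; first by rewrite mulrDr fD //; apply: iprod_mem.
  by rewrite mulrCA; apply: fM; apply: iprod_mem.
move=> Kw; have [|g [hg <-]] := @Hom_with_value w; last exact: Hom_eval_tr.
move=> v Jv; have ky k : icap I J k -> exists t, k * v = y * t.
  by move=> [_ Jk]; apply: (self_gen_quo gy).
exists (quo y (w * v)); last exact: quoK (ky w Kw).
suff: icap I J (quo y (w * v)) by case.
apply: (trace_linear (f := fun k => quo y (k * v))) => //.
by apply: quo_linear => //; split=> [u1 u2|r u1] *; ring.
Qed.

End Pair.

(** The twists in the two directions are mutually inverse: each carries the value at one generator
    to the other, and such a value determines the map. *)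
Lemma Hom_iso_swap I J x y : is_ideal I -> is_ideal J ->
  trace_ideal I -> trace_ideal J -> self_gen I x -> self_gen J y -> iso_HH I J J I.
Proof.
move=> hI hJ trI trJ gx gy; have [Ix nx _] := gx; have [Jy ny _] := gy.
have tE := twist_gen x gy.
exists (twist J x y); split; first by move=> f; apply: twist_Hom.
split.
  move=> f g hf hg e; apply: (Hom_inj hf hg Ix nx).
  by rewrite -(tE f) -(tE g) e.
split.
  move=> g hg; exists (twist I y x g); have hf := twist_Hom hI trJ gy gx hg.
  split=> //; apply: (Hom_inj (twist_Hom hJ trI gx gy hf) hg Jy ny).
  by rewrite tE (twist_gen _ gx).
have quoJ a v : J a -> J v -> y * quo y (a * v) = a * v.
  by move=> Ja Jv; rewrite -quoK //; apply: (self_gen_quo gy).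
split=> [f g [fJ _] [gJ _]|r f [fJ _]];
  apply: functional_extensionality => v; rewrite /fadd /fscale /twist;
  case: (classic (J v)) => Jv; rewrite ?(restrE _ Jv) ?restr_out ?addr0 ?mulr0 //;
  apply: (nzd_cancel ny).
  have [Jf Jg] := (fJ _ Ix, gJ _ Ix).
  by rewrite mulrDr !quoJ ?mulrDl //; apply: idealD.
have Jf := fJ _ Ix.
by rewrite mulrCA !quoJ ?mulrA //; apply: idealM.
Qed.

End Homs.

End Ideals.

Theorem theorem5p4 (R : comNzRingType) (m I J : R -> Prop) :
  CM1_local m ->
  is_ideal I -> regular I -> stable I -> trace_ideal I ->
  is_ideal J -> regular J -> stable J -> trace_ideal J ->
  iso_HH I J J I /\
  iso_HI J I (tr (iprod I J)) /\
  (stable (icap I J) -> trace_ideal (icap I J) ->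
     iso_II (tr (iprod I J)) (icap I J)).
Proof.
move=> hm hI rI sI tI hJ rJ sJ tJ.
have [x gx] := stable_principal hm hI rI sI.
have [y gy] := stable_principal hm hJ rJ sJ.
split; first exact: (Hom_iso_swap hI hJ tI tJ gx gy).
split; first exact: (Hom_iso_tr hI hJ tI gx gy).
move=> _ tK; rewrite (tr_iprod_icap hI hJ tI tJ gx gy tK).
exists id; split=> //; split=> //; split=> // w hw.
by exists w.
Qed.
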